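(* Let $G$ be a finite group, $S\subset G$, and consider $\Gamma^*=X^*(G,S)$ and $\Gamma^*_S=MX^*(G;S,S)$. Then: (a) $\Gamma^*_S$ is hypoenergetic if and only if $\Gamma^*$ is hypoenergetic. (b) $\Gamma^*_S$ is orderenergetic if and only if $\Gamma^*$ is orderenergetic. (c) If $\Gamma^*_S$ is hyperenergetic, then $\Gamma^*$ is hyperenergetic. Furthermore, if $\Gamma^*$ is weak hyperenergetic, then $\Gamma^*_S$ is hyperenergetic if and only if $\Gamma^*$ is hyperenergetic.
   Context: $X(G,S)$ is the Cayley graph with vertex set $G$ and a directed edge from $h$ to $g$ iff $gh^{-1}\in S$; $X^+(G,S)$ is the Cayley sum graph with vertex set $G$ and a directed edge from $h$ to $g$ iff $gh\in S$ (loops allowed). $X^*(G,S)$ denotes either one; a statement with $*$ is asserted for both choices, the same choice being made throughout. If $A$ is the adjacency matrix of $\Gamma^*$, then $\Gamma^*_S=MX^*(G;S,S)$ is the graph with vertex set $G\times\mathbb{Z}_2$ and adjacency matrix $\begin{pmatrix}A&A\\ A&A\end{pmatrix}$, i.e. with a directed edge from $(h,i)$ to $(g,j)$ (any $i,j\in\mathbb{Z}_2$) iff there is one from $h$ to $g$ in $\Gamma^*$. $Spec$ is the multiset of complex eigenvalues of the adjacency matrix counted with (algebraic) multiplicity, and the energy is $\mathcal{E}(\Gamma)=\sum_{\lambda\in Spec(\Gamma)}|\lambda|$. A graph $\Gamma$ with $n$ vertices is hypoenergetic if $\mathcal{E}(\Gamma)<n$, orderenergetic if $\mathcal{E}(\Gamma)=n$,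 hyperenergetic if $\mathcal{E}(\Gamma)>2n-2$, and weak hyperenergetic if $\mathcal{E}(\Gamma)>2n-1$. (Note that $\Gamma^*_S$ has $2|G|$ vertices.) *)

(* Defs.v *)
From mathcomp Require Import all_boot all_order all_fingroup all_algebra.
From mathcomp Require Import reals complex.

Set Implicit Arguments.
Unset Strict Implicit.
Unset Printing Implicit Defensive.

Import Order.TTheory GRing.Theory Num.Theory.
Local Open Scope ring_scope.

(* A directed graph (loops allowed) on the vertex type V is a boolean relation
   e : rel V, where e h g says that there is a directed edge from h to g. *)

Inductive cayley_kind := Difference | Sum.

(* X^*(G, S), where G is the whole group gT. *)
Definition Xstar (k : cayley_kind) (gT : finGroupType) (S : {set gT}) : rel gT :=
  match k with
  | Difference => [rel h g | (g * h^-1)%g \in S]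
  | Sum        => [rel h g | (g * h)%g \in S]
  end.

(* MX^*(G; S, S): the second coordinates place no condition on the edges, which
   gives the adjacency matrix (A A; A A). *)
Definition MXstar (k : cayley_kind) (gT : finGroupType) (S : {set gT}) :
    rel (gT * 'Z_2)%type :=
  [rel u v | Xstar k S u.1 v.1].

Section Energy.
Variable R : realType.

Definition adjacency_mx (V : finType) (e : rel V) : 'M[R[i]]_#|V| :=
  \matrix_(i, j) (e (enum_val i) (enum_val j))%:R.

(* The roots of the characteristic polynomial, each listed as many times as its
   algebraic multiplicity; only the order of the list is arbitrary. *)
Definition spectrum (n : nat) (A : 'M[R[i]]_n) : seq R[i] :=
  sval (closed_field_poly_normal (char_poly A)).

Lemma char_poly_spectrum (n : nat) (A : 'M[R[i]]_n) :
  char_poly A = \prod_(z <- spectrum A) ('X - z%:P).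
Proof.
rewrite /spectrum; case: closed_field_poly_normal => r /= {1}->.
by rewrite (monicP (char_poly_monic A)) scale1r.
Qed.

Definition Spec (V : finType) (e : rel V) : seq R[i] :=
  spectrum (adjacency_mx e).

(* Normc.normc is the modulus, with values in R. *)
Definition energy (V : finType) (e : rel V) : R :=
  \sum_(z <- Spec e) Normc.normc z.

Definition hypoenergetic (V : finType) (e : rel V) : Prop :=
  energy e < #|V|%:R.

Definition orderenergetic (V : finType) (e : rel V) : Prop :=
  energy e = #|V|%:R.

Definition hyperenergetic (V : finType) (e : rel V) : Prop :=
  energy e > 2 * #|V|%:R - 2.

Definition weak_hyperenergetic (V : finType) (e : rel V) : Prop :=
  energy e > 2 * #|V|%:R - 1.

End Energy.

(* Main.v *)
Require Import Defs.
From mathcomp Require Import all_boot all_order all_fingroup all_algebra.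
From mathcomp Require Import reals complex.
From mathcomp Require Import lra.

(** The projection [(g, i) |-> g] from the vertices of [MX^*(G; S, S)] to those
    of [X^*(G, S)] is two-to-one, and the edges upstairs are exactly the pullback
    of the edges downstairs.  Writing [P] for the 0-1 matrix of the projection,
    the two adjacency matrices [B] (upstairs) and [A] (downstairs) are related by
    [B = P A P^T] with [P^T P = 2 I].  Now [(P A) P^T] and [P^T (P A) = 2 A] have
    the same characteristic polynomial up to a power of the variable
    ([char_poly_mulmxC]), so the nonzero eigenvalues of [B] are those of [A],
    doubled, with the same multiplicities.  Hence the energy doubles
    ([energy_pullback]), just as the number of vertices does.

    With energy [E] and [n] vertices downstairs, hypoenergetic and orderenergetic
    upstairs read [2 E < 2 n] and [2 E = 2 n], which are the conditions
    downstairs; hyperenergetic upstairs reads [2 E > 4 n - 2], i.e.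
    [E > 2 n - 1], which is weak hyperenergeticity downstairs and implies
    [E > 2 n - 2]. *)

Set Implicit Arguments.
Unset Strict Implicit.
Unset Printing Implicit Defensive.

Import Order.TTheory GRing.Theory Num.Theory.
Local Open Scope ring_scope.

(** Sylvester's determinant identity.  Both sides are ['X^n * \det K] for the
    block matrix [K = ('X M; N 1)].  Clearing the block [N] with column
    operations shows that [\det K] is the determinant of ['X - M N].  Scaling
    the second block row by ['X] multiplies [\det K] by ['X^n]; clearing [N]
    with row operations then leaves the diagonal blocks ['X] and ['X - N M]. *)
Lemma char_poly_mulmxC (F : comNzRingType) (m n : nat)
    (M : 'M[F]_(m, n)) (N : 'M[F]_(n, m)) :
  'X^n * char_poly (M *m N) = 'X^m * char_poly (N *m M).
Proof.
pose M' := map_mx polyC M; pose N' := map_mx polyC N.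
pose K := block_mx 'X%:M M' N' 1%:M.
have -> : char_poly (M *m N) = \det K.
  have KE : K *m block_mx 1%:M 0 (- N') 1%:M
            = block_mx (char_poly_mx (M *m N)) M' 0 1%:M.
    rewrite mulmx_block !mulmx1 !mul1mx !mulmx0 !add0r mulmxN subrr.
    by rewrite /char_poly_mx map_mxM.
  have /(congr1 determinant) := KE.
  by rewrite det_mulmx det_lblock det_ublock !det1 !mulr1.
have LK : block_mx 1%:M 0 (- N') 'X%:M *m K
          = block_mx 'X%:M M' 0 (char_poly_mx (N *m M)).
  rewrite mulmx_block !mul1mx !mul0mx !addr0 mulmx1 mulNmx.
  by rewrite -scalar_mxC addNr /char_poly_mx map_mxM mulNmx addrC.
have /(congr1 determinant) := LK.
by rewrite det_mulmx det_lblock det_ublock det1 mul1r !det_scalar.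
Qed.

Lemma char_poly_scale_roots (F : fieldType) (n : nat) (A : 'M[F]_n) (c : F)
    (s : seq F) :
  c != 0 -> char_poly A = \prod_(z <- s) ('X - z%:P) ->
  char_poly (c *: A) = \prod_(z <- s) ('X - (c * z)%:P).
Proof.
move=> c0 As.
have size_s : size s = n.
  by apply: succn_inj; rewrite -(size_char_poly A) As size_prod_XsubC.
have subst_scale z : c%:P * (c^-1 *: 'X - z%:P) = 'X - (c * z)%:P.
  by rewrite mulrBr mul_polyC scalerA divff // scale1r polyCM.
(* Substituting 'X / c for 'X and multiplying each row, respectively each root
   factor, by c turns the characteristic polynomial of A into that of c A. *)
transitivity (c%:P ^+ n * (char_poly A \Po (c^-1 *: 'X))).
  rewrite /char_poly -det_map_mx -detZ; congr (\det _).
  apply/matrixP=> i j; rewrite !mxE /= comp_polyB comp_polyC rmorphMn /=.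
  rewrite comp_polyX mulrBr -polyCM mulrnAr; congr (_ *+ _ - _).
  by rewrite mul_polyC scalerA divff // scale1r.
rewrite As rmorph_prod -(eq_bigr _ (fun z _ => subst_scale z)) big_split /=.
rewrite big_const_seq count_predT iter_mulr_1 size_s; congr (_ * _).
by apply: eq_bigr => z _; rewrite comp_polyB comp_polyX comp_polyC.
Qed.

Section Pullback.
Variable R : realType.

(** With [P] the 0-1 matrix of [f] and [Q] its transpose, the pullback has
    adjacency matrix [P A Q] and [Q P] is [d] times the identity, because it
    counts the vertices of each fibre.  So the spectrum upstairs is that of
    [d A] up to zeros, and zeros contribute nothing to the energy. *)
Lemma energy_pullback (V W : finType) (f : W -> V) (e : rel V) (d : nat) :
  (0 < d)%N -> (forall v, #|[pred w | f w == v]| = d) ->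
  energy R [rel u v | e (f u) (f v)] = d%:R * energy R e.
Proof.
move=> d_gt0 fibre_card.
have d_neq0 : d%:R != 0 :> R[i] by rewrite pnatr_eq0 -lt0n.
pose A := adjacency_mx R e.
pose g (w : 'I_#|W|) : 'I_#|V| := enum_rank (f (enum_val w)).
pose P : 'M[R[i]]_(_, _) := rowsub g 1%:M.
pose Q : 'M[R[i]]_(_, _) := colsub g 1%:M.
have BE : adjacency_mx R [rel u v | e (f u) (f v)] = (P *m A) *m Q.
  rewrite /P mul_rowsub_mx mul1mx /Q mulmx_colsub mulmx1.
  by apply/matrixP=> i j; rewrite !mxE /= !enum_rankK.
have QP : Q *m P = d%:R%:M.
  apply/matrixP=> i j; rewrite !mxE.
  have -> : \sum_w Q i w * P w j = \sum_(w | g w == i) (i == j)%:R.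
    rewrite [RHS]big_mkcond /=; apply: eq_bigr => w _; rewrite !mxE eq_sym.
    by case: eqP => [->|_]; rewrite ?mul1r ?mul0r.
  rewrite sumr_const; have -> : #|[pred w | g w == i]| = d.
    rewrite -(fibre_card (enum_val i)) -[LHS]sum1_card -[RHS]sum1_card.
    rewrite [RHS](reindex _ (onW_bij _ (@enum_val_bij W))) /=.
    by apply: eq_bigl => w; rewrite !inE /= -(can_eq enum_rankK) enum_valK.
  by rewrite -mulrnA mulnC mulrnA.
have char_BA : 'X^#|V| * char_poly (adjacency_mx R [rel u v | e (f u) (f v)])
    = 'X^#|W| * \prod_(z <- Spec R e) ('X - (d%:R * z)%:P).
  rewrite BE char_poly_mulmxC mulmxA QP mul_scalar_mx.
  by rewrite (char_poly_scale_roots d_neq0 (char_poly_spectrum A)).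
(* Powers of 'X are products of factors 'X - 0: unique factorisation then makes
   the two spectra, padded with zeros, permutations of each other. *)
have Spec_perm : perm_eq
    (nseq #|V| 0 ++ Spec R [rel u v | e (f u) (f v)])
    (nseq #|W| 0 ++ [seq d%:R * z | z <- Spec R e]).
  have prod_nseq0 m : \prod_(z <- nseq m (0 : R[i])) ('X - z%:P) = 'X^m.
    by rewrite big_nseq subr0 iter_mulr_1.
  apply: prod_XsubC_eq.
  by rewrite !big_cat !prod_nseq0 big_map -char_poly_spectrum.
have sum_normc_cat0 m s : \sum_(z <- nseq m 0 ++ s) Normc.normc z
    = \sum_(z <- s) Normc.normc z :> R.
  by rewrite big_cat big_nseq Normc.normc0 iter_addr_0 mul0rn /= add0r.
rewrite /energy -(sum_normc_cat0 #|V|) (perm_big _ Spec_perm) sum_normc_cat0.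
rewrite big_map mulr_sumr; apply: eq_bigr => z _.
by rewrite !mulr_natl normcMn.
Qed.

Lemma energy_MXstar (k : cayley_kind) (gT : finGroupType) (S : {set gT}) :
  energy R (MXstar k S) = 2 * energy R (Xstar k S).
Proof.
apply: (@energy_pullback gT _ (fun u : gT * 'Z_2 => u.1)) => // g.
have -> : #|[pred u : gT * 'Z_2 | u.1 == g]| = #|setX [set g] [set: 'Z_2]|.
  by apply: eq_card => -[h i]; rewrite !inE andbT.
by rewrite cardsX cards1 cardsT card_ord.
Qed.

End Pullback.

Theorem proposition5p2 (R : realType) (k : cayley_kind) (gT : finGroupType)
    (S : {set gT}) :
  (hypoenergetic R (MXstar k S) <-> hypoenergetic R (Xstar k S)) /\
  (orderenergetic R (MXstar k S) <-> orderenergetic R (Xstar k S)) /\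
  ((hyperenergetic R (MXstar k S) -> hyperenergetic R (Xstar k S)) /\
   (weak_hyperenergetic R (Xstar k S) ->
     (hyperenergetic R (MXstar k S) <-> hyperenergetic R (Xstar k S)))).
Proof.
rewrite /hypoenergetic /orderenergetic /hyperenergetic /weak_hyperenergetic.
(* Energy and number of vertices both double, so all that remains is linear
   arithmetic. *)
rewrite energy_MXstar card_prod card_ord (natrM _ _ 2).
move: (energy R _) (#|gT|%:R : R) => E n.
do 2![split; first by split; lra].
by split; [lra | split; lra].
Qed.
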